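(* Let $(G,+)$ be a finite abelian group, $(p_g)_{g\in G}\subset(0,1)$ with $\sum_gp_g=1$, $\Omega=G^{\mathbb N}$, $\mathbb P$ the Bernoulli measure $\mathbb P[g_0,\dots,g_{n-1}]=\prod_{j<n}p_{g_j}$, $N\ge2$ an integer, $\Phi:\Omega\to\Omega$ given by $(\Phi\omega)_j=\omega_j+\dots+\omega_{j+N-1}$, and $\mathbb P_0=\mathbb P\circ\Phi^{-1}$. Then: (a) $\mathbb P_0$ is $T$-invariant; (b) $\mathbb P_0$ is ψ-mixing; (c) if there exists $h\in G$ with $p_h>p_g$ for all $g\in G\setminus\{h\}$, then there exists $s\in G$ such that, for the constant sequence $\omega$ with $\omega_j=s$ for all $j\ge0$, the limit $\lim_{n\to\infty}\mathbb P_0(A^\omega_{n+1}\mid A^\omega_n)$ does not exist.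
   Context: $T$ is the left shift on $G^{\mathbb N}$; cylinders $[g_0,\dots,g_{n-1}]=\{\omega:\omega_j=g_j,0\le j<n\}$; $A^\omega_n=[\omega_0,\dots,\omega_{n-1}]$. A probability measure $Q$ on $G^{\mathbb N}$ (with the σ-algebra $\mathcal F$ generated by coordinates) is ψ-mixing if there is a sequence $\psi_m\ge0$ with $\psi_m\to0$ such that $|Q(E\cap T^{-(n+m)}F)-Q(E)Q(F)|\le\psi_mQ(E)Q(F)$ for all $m,n\in\mathbb N$, $E$ in the σ-algebra generated by coordinates $0,\dots,n-1$, and $F\in\mathcal F$. *)

(* Defs.v *)
From HB Require Import structures.
From mathcomp Require Import all_boot all_algebra.
From Stdlib Require Import Reals.

Set Implicit Arguments.
Unset Strict Implicit.
Unset Printing Implicit Defensive.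

Local Open Scope R_scope.

Definition event (G : Type) := (nat -> G) -> Prop.

Inductive sigma_gen (X : Type) (C : (X -> Prop) -> Prop) : (X -> Prop) -> Prop :=
| sg_base A : C A -> sigma_gen C A
| sg_ext A B : sigma_gen C A -> (forall x, A x <-> B x) -> sigma_gen C B
| sg_compl A : sigma_gen C A -> sigma_gen C (fun x => ~ A x)
| sg_union (A : nat -> X -> Prop) :
    (forall k, sigma_gen C (A k)) -> sigma_gen C (fun x => exists k, A k x).

Definition measurable (G : Type) : event G -> Prop :=
  sigma_gen (fun A => exists (j : nat) (g : G), A = (fun w => w j = g)).

Definition measurable_upto (G : Type) (n : nat) : event G -> Prop :=
  sigma_gen (fun A => exists (j : nat) (g : G), is_true (ltn j n) /\ A = (fun w => w j = g)).

(* Q is a probability measure on (G^N, F) (its values off F are irrelevant). *)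
Record prob_measure (G : Type) (Q : event G -> R) : Prop := {
  pm_nonneg : forall A, measurable A -> 0 <= Q A;
  pm_total : Q (fun _ => True) = 1;
  pm_sigma_add : forall A : nat -> event G,
      (forall k, measurable (A k)) ->
      (forall k l w, k <> l -> A k w -> A l w -> False) ->
      infinite_sum (fun k => Q (A k)) (Q (fun w => exists k, A k w))
}.

Definition cylinder (G : Type) (w : nat -> G) (n : nat) : event G :=
  fun x => forall j, is_true (ltn j n) -> x j = w j.

Definition shift (G : Type) (w : nat -> G) : nat -> G := fun j => w j.+1.
Definition shiftn (G : Type) (k : nat) (w : nat -> G) : nat -> G :=
  fun j => w (addn j k).

Definition bernoulli (G : Type) (p : G -> R) (P : event G -> R) : Prop :=
  forall (n : nat) (w : nat -> G),
    P (cylinder w n) = \big[Rmult/R1]_(i < n) p (w i).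

Definition Phi (G : zmodType) (N : nat) (w : nat -> G) : nat -> G :=
  fun j => \big[GRing.add/GRing.zero]_(i < N) w (addn j i).

Definition pushforward (G : zmodType) (N : nat) (P : event G -> R) : event G -> R :=
  fun E => P (fun w => E (Phi N w)).

Definition T_invariant (G : Type) (Q : event G -> R) : Prop :=
  forall E, measurable E -> Q (fun w => E (shift w)) = Q E.

Definition psi_mixing (G : Type) (Q : event G -> R) : Prop :=
  exists psi : nat -> R,
    (forall m, 0 <= psi m) /\ Un_cv psi 0 /\
    forall (m n : nat) (E F : event G),
      measurable_upto n E -> measurable F ->
      Rabs (Q (fun w => E w /\ F (shiftn (addn n m) w)) - Q E * Q F)
        <= psi m * Q E * Q F.

Definition cond_prob (G : Type) (Q : event G -> R) (A B : event G) : R :=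
  Q (fun w => A w /\ B w) / Q B.

(* Main.v *)
Require Import Defs.
From HB Require Import structures.
From mathcomp Require Import all_boot all_algebra Rstruct.
From Stdlib Require Import Reals Lra Classical FunctionalExtensionality.
From Stdlib Require Import PropExtensionality.

(* Events of the first [k] coordinates are independent of events of the
   coordinates from [k] on, so invariance passes to the image measure, and the
   image of a block of length [n] uses [N - 1] further coordinates only: the
   mixing coefficient vanishes for gaps [m >= N - 1].  For shorter gaps at most
   [N - 1] coordinates are shared, and a bounded coefficient suffices.

   A sequence whose image is constantly [s] on the first [n] coordinates is
   [N]-periodic up to [n + N - 1], with a period [a] of sum [s].  Hence the
   probability of [s ... s] is the sum over such [a] of products of [p] along
   the periodic word, and it is governed by the [a] maximising
   [p a_0 * ... * p a_(N-1)].  Let [g] be a second most likely letter and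
   [s = g + (N - 1) h]: the maximisers are exactly the [N] words with one
   letter [g] and all others [h].  If the conditional probabilities converged,
   the sums [S_r] over the maximisers of the weights of their prefixes of
   length [r] would be a geometric progression, so
   [S_1 * S_(N-1) = S_0 * S_N]; this is the equality case of the inequality
   between the arithmetic and harmonic means of [p] over a maximiser, and
   forces [p g = p h]. *)

Set Implicit Arguments.
Unset Strict Implicit.
Unset Printing Implicit Defensive.

Local Open Scope R_scope.

Lemma pred_eqP (X : Type) (A B : X -> Prop) : (forall x, A x <-> B x) -> A = B.
Proof.
by move=> AB; apply: functional_extensionality => x; apply: propositional_extensionality.
Qed.

(** * Dynkin's π-λ theorem *)

Section Dynkin.
Variables (X : Type) (C : (X -> Prop) -> Prop).

(** The λ-system generated by [C]: an identity between measures passes through complements and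
    disjoint unions, but not through arbitrary unions. *)
Inductive dynkin : (X -> Prop) -> Prop :=
| dynkin_base A : C A -> dynkin A
| dynkin_compl A : dynkin A -> dynkin (fun x => ~ A x)
| dynkin_union (A : nat -> X -> Prop) :
    (forall k, dynkin (A k)) ->
    (forall k l x, k <> l -> A k x -> A l x -> False) ->
    dynkin (fun x => exists k, A k x).

Hypothesis C0 : C (fun=> False).
Hypothesis CI : forall A B, C A -> C B -> C (fun x => A x /\ B x).

Lemma dynkin_disjointU A B : dynkin A -> dynkin B ->
  (forall x, A x -> B x -> False) -> dynkin (fun x => A x \/ B x).
Proof.
move=> dA dB AB.
pose F k := if k is 0%nat then A else if k is 1%nat then B else fun=> False.
rewrite (_ : (fun x => _) = fun x => exists k, F k x).
  apply: dynkin_union.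
    by move=> [|[|k]] //=; apply: dynkin_base.
  by move=> [|[|k]] [|[|l]] x //= _ a b; apply: (AB x).
apply: pred_eqP => x; split=> [[a|b]|[[|[|k]]]] //=; last first.
- by right.
- by left.
- by exists 1%nat.
- by exists 0%nat.
Qed.

Lemma dynkin_diff A B : dynkin A -> dynkin B ->
  (forall x, B x -> A x) -> dynkin (fun x => A x /\ ~ B x).
Proof.
move=> dA dB BA.
rewrite (_ : (fun x => _) = fun x => ~ (~ A x \/ B x)).
  by apply/dynkin_compl/dynkin_disjointU => //; [exact: dynkin_compl | move=> x nA /BA].
by apply: pred_eqP => x; tauto.
Qed.

Lemma dynkin_interl A B : C A -> dynkin B -> dynkin (fun x => A x /\ B x).
Proof.
move=> cA; elim=> {B} [B cB|B dB IH|B dB IH disj].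
- exact/dynkin_base/CI.
(* Written this way, the set removed is contained in [A], as [dynkin_diff] requires. *)
- rewrite (_ : (fun x => _) = fun x => A x /\ ~ (A x /\ B x)).
    by apply: dynkin_diff => //; [exact: dynkin_base | move=> x []].
  by apply: pred_eqP => x; tauto.
- rewrite (_ : (fun x => _) = fun x => exists k, A x /\ B k x).
    by apply: dynkin_union => // k l x kl [_ bk] [_ bl]; apply: (disj k l x).
  by apply: pred_eqP => x; split=> [[a [k b]]|[k [a b]]]; [exists k | split=> //; exists k].
Qed.

(** Second stage of the usual bootstrap: [dynkin_interl] settles [A] in [C], and the same induction,
    now on [A], extends it to the whole λ-system. *)
Lemma dynkin_inter A B : dynkin A -> dynkin B -> dynkin (fun x => A x /\ B x).
Proof.
move=> dA dB; elim: dA => {A} [A cA|A dA IH|A dA IH disj].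
- exact: dynkin_interl.
- rewrite (_ : (fun x => _) = fun x => B x /\ ~ (A x /\ B x)).
    by apply: dynkin_diff => // x [].
  by apply: pred_eqP => x; tauto.
- rewrite (_ : (fun x => _) = fun x => exists k, A k x /\ B x).
    by apply: dynkin_union => // k l x kl [bk _] [bl _]; apply: (disj k l x).
  by apply: pred_eqP => x; split=> [[[k a] b]|[k [a b]]]; [exists k | split=> //; exists k].
Qed.

Lemma ex_least (Q : nat -> Prop) k : Q k ->
  exists m, Q m /\ forall i, (i < m)%nat -> ~ Q i.
Proof.
elim/ltn_ind: k => k IH Qk.
have [[i [ik Qi]]|no] := classic (exists i, (i < k)%nat /\ Q i); first exact: (IH i).
by exists k; split=> // i ik Qi; apply: no; exists i.
Qed.

Lemma sigma_gen_dynkin A : sigma_gen C A -> dynkin A.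
Proof.
elim=> {A} [A /dynkin_base //|A B _ dA AB|A _ /dynkin_compl //|A _ dA].
  by rewrite -(pred_eqP AB).
have dn k : dynkin (fun x => forall i, (i < k)%nat -> ~ A i x).
  elim: k => [|k IH].
    rewrite (_ : (fun x => _) = fun x : X => ~ False).
      exact/dynkin_compl/dynkin_base.
    by apply: pred_eqP => x; split=> _; first case.
  rewrite (_ : (fun x => _) = fun x => (forall i, (i < k)%nat -> ~ A i x) /\ ~ A k x).
    by apply: dynkin_inter => //; apply: dynkin_compl.
  apply: pred_eqP => x; split=> [H|[H H'] i].
    by split=> [i ik|]; apply: H => //; apply: ltnW.
  by rewrite ltnS leq_eqVlt => /orP[/eqP->|/H].
(* The union is made disjoint by assigning each point to the first [A k] that contains it. *)
rewrite (_ : (fun x => _) =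
  fun x => exists k, A k x /\ forall i, (i < k)%nat -> ~ A i x).
  apply: dynkin_union => [k|k l x kl [ak nk] [al nl]]; first exact: dynkin_inter.
  by have [/nl /(_ ak)|/nk /(_ al)|/kl] := ltngtP k l.
apply: pred_eqP => x; split=> [[k ak]|[k [ak _]]]; last by exists k.
exact: (@ex_least (fun k => A k x) k).
Qed.

End Dynkin.

(** * Measurable events of sequences over a finite alphabet *)

Section Measurability.
Variables (G : finType) (o : G).

Lemma sigma_gen_countable (X : Type) C (I : countType) (A : I -> X -> Prop) :
  sigma_gen C (fun=> False) -> (forall i, sigma_gen C (A i)) ->
  sigma_gen C (fun x => exists i, A i x).
Proof.
move=> C0 CA.
(* Numbers that code no index contribute the empty event. *)
pose B k := if unpickle k is Some i then A i else fun=> False.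
rewrite (_ : (fun x => _) = fun x => exists k, B k x).
  by apply: sg_union => k; rewrite /B; case: unpickle.
apply: pred_eqP => x; split=> [[i a]|[k]].
  by exists (pickle i); rewrite /B pickleK.
by rewrite /B; case: unpickle => // i a; exists i.
Qed.

Lemma sigma_gen_inter (X : Type) C (A B : X -> Prop) :
  sigma_gen C A -> sigma_gen C B -> sigma_gen C (fun x => A x /\ B x).
Proof.
move=> CA CB.
pose F (k : nat) := if k is 0%nat then fun x => ~ A x else fun x => ~ B x.
apply: (@sg_ext _ _ (fun x => ~ exists k, F k x)).
  by apply/sg_compl/sg_union => -[|k]; apply: sg_compl.
move=> x; split=> [H|[a b] [[|k]]] //.
by split; apply: NNPP => ?; apply: H; [exists 0%nat | exists 1%nat].
Qed.

(** A pointwise substitute for [measurable_upto]: it is easily transported through [Phi] and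
    [scons], and it still implies measurability because the alphabet is finite. *)
Definition finitary (n : nat) (A : event G) : Prop :=
  forall w w', (forall j, (j < n)%nat -> w j = w' j) -> (A w <-> A w').

(** The event is a union of cylinders over finite words. There are countably many words, each
    extended by the letter [o] to an infinite sequence. *)
Lemma finitary_sigma C n (A : event G) :
  (forall w n, sigma_gen C (@cylinder G w n)) -> finitary n A -> sigma_gen C A.
Proof.
move=> Ccyl fA.
have C0 : sigma_gen C (fun _ : nat -> G => False).
  apply: sg_ext (sg_compl (Ccyl (fun=> o) 0%nat)) _ => w.
  by split=> // H; apply: H => j.
rewrite (_ : A = fun w => exists s, A (nth o s) /\ cylinder (nth o s) n w).
  apply: sigma_gen_countable => // s.
  have [a|na] := classic (A (nth o s)).
    by apply: sg_ext (Ccyl (nth o s) n) _ => w; tauto.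
  by apply: sg_ext C0 _ => w; tauto.
apply: pred_eqP => w; split=> [a|[s [a cw]]].
  have e j : (j < n)%nat -> w j = nth o (mkseq w n) j by move=> jn; rewrite nth_mkseq.
  by exists (mkseq w n); split=> //; apply/(fA _ _ e).
exact/(fA _ _ cw).
Qed.

Lemma measurable_coord j (g : G) : measurable (fun w => w j = g).
Proof. by apply: sg_base; exists j, g. Qed.

Lemma measurable_true : measurable (fun _ : nat -> G => True).
Proof.
pose F (k : nat) w := if k is 0%nat then w 0%nat = o else w 0%nat <> o.
apply: (@sg_ext _ _ (fun w => exists k, F k w)).
  by apply: sg_union => -[|k]; [|apply: sg_compl]; apply: measurable_coord.
move=> w; split=> // _.
by have [e|e] := classic (w 0%nat = o); [exists 0%nat | exists 1%nat].
Qed.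

Lemma measurable_false : measurable (fun _ : nat -> G => False).
Proof. by apply: sg_ext (sg_compl measurable_true) _ => w; tauto. Qed.

Lemma measurable_cylinder (w : nat -> G) n : measurable (cylinder w n).
Proof.
elim: n => [|n IH]; first by apply: sg_ext measurable_true _ => x; split.
apply: sg_ext (sigma_gen_inter IH (measurable_coord n (w n))) _ => x.
split=> [[H e] j|H].
  by rewrite /= ltnS leq_eqVlt => /orP[/eqP->|/H].
by split=> [j jn|]; apply: H; rewrite /= ltnS // ltnW.
Qed.

Lemma measurable_finitary n (A : event G) : finitary n A -> measurable A.
Proof. exact/finitary_sigma/measurable_cylinder. Qed.

Lemma finitary_le m n (A : event G) : (m <= n)%nat -> finitary m A -> finitary n A.
Proof. by move=> mn fA w w' e; apply: fA => j jm; apply/e/(leq_trans jm). Qed.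

Lemma measurable_upto_finitary n (A : event G) : measurable_upto n A -> finitary n A.
Proof.
elim=> {A} [_ [j [g [jn ->]]]|A B _ fA AB|A _ fA|A _ fA] w w' e.
- by rewrite e.
- by rewrite -!AB; apply: fA.
- by have := fA _ _ e; tauto.
- by split=> -[k a]; exists k; apply/(fA k w w' e).
Qed.

Lemma measurable_preim (f : (nat -> G) -> (nat -> G)) (A : event G) :
  (forall j g, measurable (fun w => f w j = g)) -> measurable A ->
  measurable (fun w => A (f w)).
Proof.
move=> mf; elim=> {A} [_ [j [g ->]]|A B _ mA AB|A _ mA|A _ mA].
- exact: mf.
- by apply: sg_ext mA _.
- exact: sg_compl.
- exact: (@sg_union _ _ (fun k w => A k (f w))).
Qed.

Lemma measurable_shiftn k (A : event G) :
  measurable A -> measurable (fun w => A (shiftn k w)).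
Proof. by apply: measurable_preim => j g; apply: measurable_coord. Qed.

(** Under a Bernoulli measure, [fun w => A (scons g w)] is [A] conditioned on the first letter [g];
    this drives the inductions on the number of coordinates. *)
Definition scons (g : G) (w : nat -> G) : nat -> G :=
  fun j => if j is i.+1 then w i else g.

Lemma scons_eta (w : nat -> G) : scons (w 0%nat) (shift w) = w.
Proof. by apply: functional_extensionality => -[]. Qed.

Lemma measurable_scons g (A : event G) :
  measurable A -> measurable (fun w => A (scons g w)).
Proof.
apply: measurable_preim => -[|j] g' /=; last exact: measurable_coord.
have [e|e] := classic (g = g').
  by apply: sg_ext measurable_true _.
by apply: sg_ext measurable_false _.
Qed.

Lemma finitary_scons n g (A : event G) :
  finitary n.+1 A -> finitary n (fun w => A (scons g w)).
Proof. by move=> fA w w' e; apply: fA => -[|j] //= /e. Qed.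

(** A change of generators: the coordinate events are not closed under intersection, whereas
    cylinders together with the empty event form a π-system. *)
Lemma sigma_gen_cylinders (A : event G) : measurable A ->
  sigma_gen (fun B => B = (fun=> False) \/ exists w n, B = cylinder w n) A.
Proof.
elim=> {A} [_ [j [g ->]]|A B _ mA AB|A _ mA|A _ mA].
- apply: (@finitary_sigma _ j.+1); last by move=> w w' e; rewrite e.
  by move=> w n; apply: sg_base; right; exists w, n.
- exact: sg_ext mA AB.
- exact: sg_compl.
- exact: sg_union.
Qed.

(** Two cylinders are either nested or disjoint. *)
Lemma cylinders_inter (A B : event G) :
  (A = (fun=> False) \/ exists w n, A = cylinder w n) ->
  (B = (fun=> False) \/ exists w n, B = cylinder w n) ->
  (fun w => A w /\ B w) = (fun=> False)
  \/ exists w n, (fun w => A w /\ B w) = cylinder w n.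
Proof.
move=> [->|[u [m ->]]]; first by left; apply: pred_eqP; tauto.
move=> [->|[v [n ->]]]; first by left; apply: pred_eqP; tauto.
wlog mn : u m v n / (m <= n)%nat => [H|].
  have /orP[mn|nm] := leq_total m n; first exact: H.
  by rewrite (pred_eqP (fun w => and_comm (cylinder u m w) (cylinder v n w))); apply: H.
have [e|e] := classic (cylinder u m v).
  right; exists v, n; apply: pred_eqP => w; split=> [[] //|c].
  by split=> // j jm; rewrite c ?e //; apply: leq_trans mn.
left; apply: pred_eqP => w; split=> // -[c1 c2]; apply: e => j jm.
by rewrite -c1 // c2 //; apply: leq_trans mn.
Qed.

End Measurability.

(** * Finite additivity of a probability measure *)

Section ProbMeasure.
Variables (G : finType) (o : G) (P : event G -> R).
Hypothesis HP : prob_measure P.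

Lemma pm_false : P (fun=> False) = 0.
Proof.
have S := pm_sigma_add HP (fun _ => measurable_false o) (fun _ _ _ _ h _ => h).
rewrite (_ : (fun w => _) = fun=> False) in S; last first.
  by apply: pred_eqP => w; split=> // -[].
(* The series with constant term [P (fun=> False)] converges, and two consecutive partial sums, each
   within [e / 2] of the limit, differ by that term. *)
apply: cond_eq => e e0; have [M HM] := S (e / 2) ltac:(lra).
have /= h2 := HM M.+1 (le_S _ _ (le_n _)); have h1 := HM M (le_n _).
by move: h1 h2; rewrite /Rdist; split_Rabs; lra.
Qed.

Lemma pm_union A B : measurable A -> measurable B ->
  (forall w, A w -> B w -> False) -> P (fun w => A w \/ B w) = P A + P B.
Proof.
move=> mA mB AB.
pose F k : event G := if k is 0%nat then A else if k is 1%nat then B else fun=> False.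
have mF k : measurable (F k) by case: k => [|[|k]] //; apply: (measurable_false o).
have dF k l w : k <> l -> F k w -> F l w -> False.
  by case: k l => [|[|k]] [|[|l]] //= _ a b; apply: (AB w).
have S := pm_sigma_add HP mF dF.
rewrite (_ : (fun w => exists k, _) = fun w => A w \/ B w) in S; last first.
  apply: pred_eqP => w; split=> [[[|[|k]]]|[a|b]] //=; first by left.
  - by right.
  - by exists 0%nat.
  - by exists 1%nat.
apply: (UL_sequence _ _ _ S) => e e0; exists 1%nat => -[|n] hn; first by inversion hn.
rewrite (_ : sum_f_R0 _ _ = P A + P B); first by rewrite /Rdist Rminus_diag Rabs_R0.
by elim: n {hn} => //= n ->; rewrite pm_false Rplus_0_r.
Qed.

Lemma pm_compl A : measurable A -> P (fun w => ~ A w) = 1 - P A.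
Proof.
move=> mA; rewrite -(pm_total HP) (_ : (fun=> True) = fun w => A w \/ ~ A w).
  by rewrite pm_union //; [lra | exact: sg_compl].
by apply: pred_eqP => w; split=> // _; apply: classic.
Qed.

Lemma pm_le A B : measurable A -> measurable B -> (forall w, A w -> B w) -> P A <= P B.
Proof.
move=> mA mB AB; have mD : measurable (fun w => B w /\ ~ A w).
  by apply: sigma_gen_inter => //; apply: sg_compl.
rewrite (_ : B = fun w => A w \/ (B w /\ ~ A w)).
  by rewrite pm_union //; [have := pm_nonneg HP mD; lra | tauto].
by apply: pred_eqP => w; have := AB w; tauto.
Qed.

Lemma pm_sum (I : finType) (r : pred I) (A : I -> event G) :
  (forall i, measurable (A i)) -> (forall i j w, A i w -> A j w -> i = j) ->
  P (fun w => exists i, r i /\ A i w) = \big[Rplus/R0]_(i | r i) P (A i).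
Proof.
move=> mA disj; rewrite -big_filter.
have: uniq (filter r (index_enum I)) by rewrite filter_uniq // index_enum_uniq.
rewrite (_ : (fun w => _) = fun w => exists i, i \in filter r (index_enum I) /\ A i w); last first.
  by apply: pred_eqP => w; split=> -[i [ri a]]; exists i;
    move: ri; rewrite mem_filter mem_index_enum andbT.
elim: (filter _ _) => {r} [_|i s IH /= /andP[ins us]].
  rewrite big_nil -[RHS]pm_false; congr (P _).
  by apply: pred_eqP => w; split=> // -[i []].
rewrite big_cons -(IH us) -pm_union //.
- congr (P _); apply: pred_eqP => w; split=> [[j []]|[a|[j [js a]]]].
  + by rewrite in_cons => /orP[/eqP->|js] a; [left | right; exists j].
  + by exists i; rewrite in_cons eqxx.
  + by exists j; rewrite in_cons js orbT.
- apply: sigma_gen_countable => [|j]; first exact: (measurable_false o).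
  case js: (j \in s); first by apply: sg_ext (mA j) _ => w; split=> [|[]].
  by apply: sg_ext (measurable_false o) _ => w; split=> // -[].
- by move=> w a [j [js /(disj _ _ _ a) e]]; rewrite e js in ins.
Qed.

Lemma pm_partition (A : event G) : measurable A ->
  P A = \big[Rplus/R0]_(g : G) P (fun w => w 0%nat = g /\ A w).
Proof.
move=> mA; rewrite -(pm_sum xpredT).
- congr (P _); apply: pred_eqP => w; split=> [a|[g [_ [_]]]] //.
  by exists (w 0%nat).
- by move=> g; apply: sigma_gen_inter => //; apply: measurable_coord.
- by move=> g g' w [<- _] [].
Qed.

End ProbMeasure.

(** * Finite sums and products of reals *)

Section BigR.
Variables (I : finType) (r : pred I).

Lemma Rsum_le (F F' : I -> R) : (forall i, r i -> F i <= F' i) ->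
  \big[Rplus/R0]_(i | r i) F i <= \big[Rplus/R0]_(i | r i) F' i.
Proof.
move=> FF; elim/big_ind2: _ => //; first exact: Rle_refl.
by move=> *; apply: Rplus_le_compat.
Qed.

Lemma Rprod_gt0 (F : I -> R) : (forall i, r i -> 0 < F i) ->
  0 < \big[Rmult/R1]_(i | r i) F i.
Proof.
by move=> F0; elim/big_ind: _ => //; [exact: Rlt_0_1 | exact: Rmult_lt_0_compat].
Qed.

Lemma Rprod_le (F F' : I -> R) : (forall i, r i -> 0 < F i <= F' i) ->
  \big[Rmult/R1]_(i | r i) F i <= \big[Rmult/R1]_(i | r i) F' i.
Proof.
move=> FF; suff: 0 <= \big[Rmult/R1]_(i | r i) F i <= \big[Rmult/R1]_(i | r i) F' i by case.
elim/big_ind2: _ => [|x x' y y' [x0 xx] [y0 yy]|i /FF]; [lra| |lra].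
by split; [apply: Rmult_le_pos | apply: Rmult_le_compat].
Qed.

Lemma Rsum_cv (F : I -> nat -> R) (l : I -> R) : (forall i, r i -> Un_cv (F i) (l i)) ->
  Un_cv (fun n => \big[Rplus/R0]_(i | r i) F i n) (\big[Rplus/R0]_(i | r i) l i).
Proof.
move=> Fl; elim: (index_enum I) => [|i s IH].
  rewrite big_nil => e e0; exists 0%nat => n _.
  by rewrite big_nil /Rdist Rminus_diag Rabs_R0.
rewrite big_cons; case: ifP => ri.
  apply: Un_cv_ext (CV_plus _ _ _ _ (Fl i ri) IH) => n.
  by rewrite big_cons ri.
by apply: Un_cv_ext IH => n; rewrite big_cons ri.
Qed.

End BigR.

(** * Independence under the Bernoulli measure *)

Section Bernoulli.
Variables (G : finType) (o : G) (p : G -> R) (P : event G -> R).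
Hypothesis p_gt0 : forall g, 0 < p g.
Hypothesis HP : prob_measure P.
Hypothesis HB : bernoulli p P.

Lemma bernoulli_scons_cylinder g w n :
  P (fun x => x 0%nat = g /\ cylinder w n (shift x)) = p g * P (cylinder w n).
Proof.
rewrite HB (_ : (fun x => _) = cylinder (scons g w) n.+1).
  by rewrite HB big_ord_recl.
apply: pred_eqP => x; split=> [[x0 c] [|j]|c] //; first exact: c.
by split=> [|j jn]; [apply: (c 0%nat) | apply: (c j.+1)].
Qed.

Lemma bernoulli_coord g : P (fun x => x 0%nat = g) = p g.
Proof.
have := bernoulli_scons_cylinder g (fun=> g) 0.
rewrite (_ : cylinder (fun=> g) 0 = fun=> True); last by apply: pred_eqP => x; split.
rewrite (pm_total HP) Rmult_1_r => <-.
by congr (P _); apply: pred_eqP => x; tauto.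
Qed.

(** Both sides respect complements and disjoint unions in [A] and agree on cylinders, so the π-λ
    theorem applies. *)
Lemma bernoulli_head_shift g (A : event G) : measurable A ->
  P (fun w => w 0%nat = g /\ A (shift w)) = p g * P A.
Proof.
move=> /(sigma_gen_cylinders o) mA.
have mS (B : event G) : measurable B -> measurable (fun w => w 0%nat = g /\ B (shift w)).
  move=> mB; apply: sigma_gen_inter (measurable_coord _ _) _.
  by apply: measurable_preim mB => j g'; apply: measurable_coord.
have {mA} := sigma_gen_dynkin _ _ mA.
set C := (fun B : event G => _) => dynA.
(* Measurability is carried through the induction, since additivity of [P] is available for
   measurable events only. *)
suff: measurable A /\ P (fun w => w 0%nat = g /\ A (shift w)) = p g * P A by case.
have {dynA}: dynkin C A by apply: dynA; [left | exact: cylinders_inter].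
elim=> {A} [A [->|[w [n ->]]]|A _ [mA eA]|A _ IH disj].
- split; first exact: (measurable_false o).
  rewrite (_ : (fun w : nat -> G => _ /\ _) = fun=> False) ?(pm_false o HP) ?Rmult_0_r //.
  by apply: pred_eqP; tauto.
- by split; [exact: measurable_cylinder | exact: bernoulli_scons_cylinder].
- split; first exact: sg_compl.
  rewrite (pm_compl o) // Rmult_minus_distr_l Rmult_1_r -eA.
  suff -> : p g = P (fun w => w 0%nat = g /\ A (shift w))
      + P (fun w => w 0%nat = g /\ ~ A (shift w)) by lra.
  rewrite -(pm_union o HP); [|exact: mS|exact/(mS _ (sg_compl mA))|tauto].
  by rewrite -bernoulli_coord; congr (P _); apply: pred_eqP => w; tauto.
- have mA k : measurable (A k) by case: (IH k).
  split; first exact: sg_union.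
  have := pm_sigma_add HP (fun k => mS _ (mA k)).
  rewrite (_ : (fun w : nat -> G => exists k, _ /\ _) =
      (fun w => w 0%nat = g /\ exists k, A k (shift w))); last first.
    by apply: pred_eqP => w; split=> [[k [a b]]|[a [k b]]];
      [split=> //; exists k | exists k].
  move=> S; apply: UL_sequence (S _) _.
    by move=> k l w kl [_ ak] [_ al]; apply: (disj k l (shift w)).
  have cst : Un_cv (fun=> p g) (p g).
    by move=> e e0; exists 0%nat => n _; rewrite /Rdist Rminus_diag Rabs_R0.
  apply: Un_cv_ext (CV_mult _ _ _ _ cst (pm_sigma_add HP mA disj)) => n.
  rewrite scal_sum; apply: sum_eq => k _.
  by case: (IH k) => _ ->; rewrite Rmult_comm.
Qed.

Lemma bernoulli_scons (A : event G) : measurable A ->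
  P A = \big[Rplus/R0]_g (p g * P (fun w => A (scons g w))).
Proof.
move=> mA; rewrite (pm_partition o HP) //; apply: eq_bigr => g _.
rewrite -bernoulli_head_shift; last exact: measurable_scons.
congr (P _); apply: pred_eqP => w.
by split=> -[<-]; rewrite scons_eta.
Qed.

Lemma bernoulli_indep k (E F : event G) : finitary k E -> measurable F ->
  P (fun w => E w /\ F (shiftn k w)) = P E * P F.
Proof.
elim: k E => [|k IH] E fE mF.
  have e w : shiftn 0 w = w :> (nat -> G).
    by apply: functional_extensionality => j; rewrite /shiftn addn0.
  (* An event that depends on no coordinate is full or empty; one test point decides which. *)
  have [a|na] := classic (E (fun=> o)).
    have -> : E = fun=> True by apply: pred_eqP => w; split=> // _; apply/(fE _ (fun=> o)).
    rewrite (pm_total HP) Rmult_1_l; congr (P _).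
    by apply: pred_eqP => w; rewrite e; tauto.
  have -> : E = fun=> False by apply: pred_eqP => w; split=> // Ew; case: na; apply/(fE _ w).
  rewrite (pm_false o HP) Rmult_0_l -[RHS](pm_false o HP); congr (P _).
  by apply: pred_eqP => w; tauto.
have mE := measurable_finitary o fE.
rewrite (bernoulli_scons mE) big_distrl bernoulli_scons /=; last first.
  by apply: sigma_gen_inter => //; apply: measurable_shiftn.
apply: eq_bigr => g _; rewrite Rmult_assoc -IH //; last exact: finitary_scons.
congr (_ * P _); apply: pred_eqP => w.
rewrite (_ : shiftn k.+1 (scons g w) = shiftn k w) //.
by apply: functional_extensionality => j; rewrite /shiftn addnS.
Qed.

Lemma bernoulli_shiftn k (F : event G) : measurable F ->
  P (fun w => F (shiftn k w)) = P F.
Proof.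
move=> mF; have := @bernoulli_indep k (fun=> True) F (fun _ _ _ => iff_refl _) mF.
rewrite (pm_total HP) Rmult_1_l => <-; congr (P _).
by apply: pred_eqP => w; tauto.
Qed.

(* Conditioning on the coordinate [g] shared by [E] and [F] costs at most a
   factor [1 / p g <= C], and there are at most [L] shared coordinates. *)
Lemma bernoulli_overlap C k L (E F : event G) : (forall g, 1 <= C * p g) ->
  finitary (k + L) E -> measurable F ->
  P (fun w => E w /\ F (shiftn k w)) <= C ^ L * P E * P F.
Proof.
move=> HC.
have C0 : 0 <= C by have := HC o; have := p_gt0 o; nra.
elim: k E F => [|k IH] E F.
  rewrite add0n => fE mF.
  have -> : (fun w => E w /\ F (shiftn 0 w)) = fun w => E w /\ F w.
    apply: pred_eqP => w; rewrite (_ : shiftn 0 w = w) //.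
    by apply: functional_extensionality => j; rewrite /shiftn addn0.
  (* With no offset left, both events see the first letter; each step conditions on one shared
     letter. *)
  elim: L E F fE mF => [|L IH] E F fE mF.
    have mE := measurable_finitary o fE.
    rewrite /= Rmult_1_l -(@bernoulli_indep 0) // (_ : (fun w => _ /\ _) = fun w => E w /\ F w).
      exact: Rle_refl.
    apply: pred_eqP => w; rewrite (_ : shiftn 0 w = w) //.
    by apply: functional_extensionality => j; rewrite /shiftn addn0.
  have mE := measurable_finitary o fE.
  rewrite (bernoulli_scons mE) bernoulli_scons; last exact: sigma_gen_inter.
  rewrite Rmult_comm -Rmult_assoc big_distrr /=; apply: Rsum_le => g _.
  have mEg := measurable_scons o g mE; have mFg := measurable_scons o g mF.
  have leF : p g * P (fun w => F (scons g w)) <= P F.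
    rewrite -bernoulli_head_shift //; apply: (pm_le o HP) => //.
      apply: sigma_gen_inter (measurable_coord _ _) _.
      by apply: (measurable_preim (f := @shift G)) mFg => j g'; apply: measurable_coord.
    by move=> w [<-]; rewrite scons_eta.
  have := IH _ _ (finitary_scons g fE) mFg.
  have := pm_nonneg HP mEg; have := pm_nonneg HP mFg; have := p_gt0 g; have := HC g.
  move: (pow_le _ L C0) leF.
  set e := P (fun w => E _); set f := P (fun w => F _); set x := P (fun w => _ /\ _).
  move: (p g) (P F) (C ^ L) => q y c c0 qf hC q0 f0 e0 hx.
  (* The chain is [q * x <= c * e * (q * f) <= c * e * y <= c * e * y * (C * q)]: [leF] absorbs the
     factor [q], and [hC] brings it back at the price of one factor [C]. *)
  have ce : 0 <= c * e by apply: Rmult_le_pos.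
  have hq : q * x <= q * (c * e * f) by apply: Rmult_le_compat_l; lra.
  have hy : c * e * (q * f) <= c * e * y by apply: Rmult_le_compat_l.
  have : c * e * y * 1 <= c * e * y * (C * q).
    by apply: Rmult_le_compat_l => //; apply: Rmult_le_pos => //; nra.
  by lra.
(* Here only [E] sees the first letter, so averaging over it costs no factor. *)
move=> fE mF; have mE := measurable_finitary o fE.
rewrite (bernoulli_scons mE) bernoulli_scons; last first.
  by apply: sigma_gen_inter => //; apply: measurable_shiftn.
rewrite Rmult_comm -Rmult_assoc big_distrr /=; apply: Rsum_le => g _.
have := IH _ _ (finitary_scons g fE) mF.
rewrite (_ : (fun w => _ /\ F (shiftn k w)) =
  fun w => E (scons g w) /\ F (shiftn k.+1 (scons g w))).
  by have := p_gt0 g; set x := P _; set y := P _; nra.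
apply: pred_eqP => w; rewrite (_ : shiftn k.+1 (scons g w) = shiftn k w) //.
by apply: functional_extensionality => j; rewrite /shiftn addnS.
Qed.

End Bernoulli.

(** * The block sum and the preimages of constant words *)

Section BlockSum.
Variables (G : finZmodType) (K : nat).
Local Notation N := K.+1.
Local Notation "x +g y" := (GRing.add x y) (at level 50, left associativity).

Lemma Phi_shiftn k (w : nat -> G) : Phi N (shiftn k w) = shiftn k (Phi N w).
Proof.
apply: functional_extensionality => j; apply: eq_bigr => i _.
by rewrite /shiftn addnAC.
Qed.

Lemma finitary_Phi n (E : event G) : finitary n E -> finitary (n + K) (fun w => E (Phi N w)).
Proof.
move=> fE w w' e; apply: fE => j jn; apply: eq_bigr => i _; apply: e.
by rewrite -addSn leq_add // -ltnS.
Qed.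

Lemma measurable_Phi (E : event G) : measurable E -> measurable (fun w => E (Phi N w)).
Proof.
apply: measurable_preim => j g.
apply: (@measurable_finitary _ GRing.zero (j.+1 + K)).
by apply: (@finitary_Phi _ (fun w => w j = g)) => w w' ->.
Qed.

(** Both sides are the sum of the [N + 1] letters from [w j] to [w (j + N)]. *)
Lemma Phi_succ (w : nat -> G) j : Phi N w j.+1 +g w j = Phi N w j +g w (j + N)%nat.
Proof.
rewrite /Phi big_ord_recr big_ord_recl /= addn0 addSnnS.
rewrite [LHS]GRing.addrAC [X in GRing.add X _ = _]GRing.addrC.
congr (GRing.add (GRing.add _ _) _).
by apply: eq_bigr => i _; rewrite /bump /= addSnnS.
Qed.

Lemma Phi_succ_eq (w : nat -> G) j :
  Phi N w j.+1 = Phi N w j <-> w (j + N)%nat = w j.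
Proof.
have := Phi_succ w j; move=> H; split=> e; move: H; rewrite e.
  by move/GRing.addrI.
by move/GRing.addIr.
Qed.

(** The residue is always below [N], so the default value of [inord] never occurs. *)
Definition periodize (a : {ffun 'I_N -> G}) (j : nat) : G := a (inord (j %% N)).

Lemma periodize_add a j : periodize a (j + N) = periodize a j.
Proof. by rewrite /periodize modnDr. Qed.

Lemma periodize_ord a (i : 'I_N) : periodize a i = a i.
Proof. by rewrite /periodize modn_small // inord_val. Qed.

(** Of the [n + 1] conditions on the image, the first fixes the sum of the first block [a], and each
    of the other [n] copies one more letter from [N] places earlier. *)
Lemma Phi_constantE s n :
  (fun w => cylinder (fun=> s) n.+1 (Phi N w)) =
  (fun w => exists a : {ffun 'I_N -> G},
     \big[GRing.add/GRing.zero]_i a i == s /\ cylinder (periodize a) (n + N) w).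
Proof.
apply: pred_eqP => w; split=> [c|[a [/eqP sa c]]].
  exists [ffun i : 'I_N => w i]; split.
    by rewrite -(c 0%nat) //; apply/eqP/eq_bigr => i _; rewrite ffunE.
  elim/ltn_ind=> j IH /= jn; have [jN|Nj] := ltnP j N.
    by rewrite -[j]/(val (Ordinal jN)) periodize_ord ffunE.
  move: IH jn; rewrite -(subnK Nj); set i := (j - N)%nat => IH; rewrite ltn_add2r => ltin.
  rewrite periodize_add -IH; last first.
  - exact: leq_trans ltin (leq_addr _ _).
  - by rewrite -addSnnS leq_addr.
  by apply/Phi_succ_eq; rewrite !c //= ltnS ltnW.
elim=> [_|j IH /= jn].
  rewrite -sa; apply: eq_bigr => i _; rewrite add0n c ?periodize_ord //=.
  by rewrite (leq_trans (ltn_ord i)) // leq_addl.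
rewrite -IH //=; last exact: ltnW.
have jnN : (j + N < n + N)%nat by rewrite ltn_add2r.
apply/Phi_succ_eq; rewrite !c ?periodize_add //.
by apply: leq_trans jnN; rewrite ltnS leq_addr.
Qed.

(** The block is read off the first [N] coordinates; hence the union in [Phi_constantE] is
    disjoint. *)
Lemma periodize_cylinder_inj n (a b : {ffun 'I_N -> G}) w :
  cylinder (periodize a) (n + N) w -> cylinder (periodize b) (n + N) w -> a = b.
Proof.
move=> ca cb; apply/ffunP => i.
have iN : (i < n + N)%nat by rewrite (leq_trans (ltn_ord i)) // leq_addl.
by rewrite -!periodize_ord -ca // -cb.
Qed.

End BlockSum.

(** * Invariance and ψ-mixing of the image measure *)

Section Mixing.
Variables (G : finZmodType) (K : nat) (p : G -> R) (P : event G -> R).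
Local Notation N := K.+1.
Hypothesis p01 : forall g, 0 < p g < 1.
Hypothesis HP : prob_measure P.
Hypothesis HB : bernoulli p P.
Let o : G := GRing.zero.

Let p_gt0 g : 0 < p g. Proof. by case: (p01 g). Qed.

Lemma pushforward_invariant : T_invariant (pushforward N P).
Proof.
move=> E mE; rewrite /pushforward -(bernoulli_shiftn o HP HB 1 (measurable_Phi K mE)).
congr (P _); apply: pred_eqP => w; rewrite Phi_shiftn.
rewrite (_ : shiftn 1 (Phi N w) = shift (Phi N w)) //.
by apply: functional_extensionality => j; rewrite /shiftn addn1.
Qed.

Lemma pushforward_psi_mixing : psi_mixing (pushforward N P).
Proof.
(* The sum of all inverses dominates each of them, which gives one constant valid for every
   letter. *)
pose C := \big[Rplus/R0]_g / p g.
have HC g : 1 <= C * p g.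
  rewrite /C (bigD1 g) //= Rmult_plus_distr_r Rinv_l; last by have := p_gt0 g; lra.
  set S := bigop.body _ _ _; suff : 0 <= S by have := p_gt0 g; nra.
  rewrite {}/S.
  elim/big_ind: _ => [|*|i _]; [lra|exact: Rplus_le_le_0_compat|].
  exact/Rlt_le/Rinv_0_lt_compat.
have C1 : 1 <= C by have := HC o; have := p01 o; nra.
have CK := pow_R1_Rle _ K C1.
exists (fun m => if (m < K)%nat then C ^ K else 0); split; [|split].
- by move=> m; case: ifP => _; lra.
- move=> e e0; exists K => m /leP mK.
  by rewrite ltnNge mK /Rdist Rminus_diag Rabs_R0.
move=> m n E F mE mF; have fE := measurable_upto_finitary mE.
have fE' := finitary_Phi (K := K) fE; have mF' := measurable_Phi K mF.
have mE' := measurable_finitary o fE'.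
rewrite /pushforward; rewrite (_ : (fun w => _ /\ _) =
  fun w => E (Phi N w) /\ F (Phi N (shiftn (n + m) w))); last first.
  by apply: pred_eqP => w; rewrite Phi_shiftn.
have [mK|Km] := ltnP m K.
  (* The true overlap has [K - m] coordinates; counting it as [K] gives a bound that does not depend
     on [m]. *)
  have fE'' : finitary (n + m + K) (fun w => E (Phi N w)).
    by apply: finitary_le fE'; rewrite addnAC leq_addr.
  have := bernoulli_overlap o p_gt0 HP HB HC fE'' mF'.
  have := pm_nonneg HP mE'; have := pm_nonneg HP mF'.
  have := pm_nonneg HP (sigma_gen_inter mE' (measurable_shiftn (n + m) mF')).
  set x := P _; set a := P _; set b := P _ => x0 b0 a0 le.
  have ab0 : 0 <= b * a by apply: Rmult_le_pos.
  (* Both the joint probability and the product lie between 0 and [C ^ K] times the product, which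
     bounds their distance. *)
  have : 1 * (b * a) <= C ^ K * (b * a) by apply: Rmult_le_compat_r.
  by move=> ?; apply: Rabs_le; lra.
rewrite (bernoulli_indep o HP HB (E := fun w => E (Phi N w)) (F := fun w => F (Phi N w))) //.
  by rewrite Rminus_diag Rabs_R0; lra.
by apply: finitary_le fE'; rewrite leq_add2l.
Qed.

End Mixing.

Lemma Un_cv_const c : Un_cv (fun=> c) c.
Proof. by move=> e e0; exists 0%nat => n _; rewrite /Rdist Rminus_diag Rabs_R0. Qed.

Lemma Un_cv_subseq (u : nat -> R) l (f : nat -> nat) : (forall n, (n <= f n)%nat) ->
  Un_cv u l -> Un_cv (fun n => u (f n)) l.
Proof.
move=> nf ul e /ul[M HM]; exists M => n /leP Mn.
by apply/HM/leP/(leq_trans Mn).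
Qed.

(** * Asymptotics of the probability of a constant word *)

Section ConstantWord.
Variables (G : finZmodType) (K : nat) (p : G -> R) (P : event G -> R).
Local Notation N := K.+1.
Local Notation Q := (pushforward N P).
Hypothesis p01 : forall g, 0 < p g < 1.
Hypothesis HP : prob_measure P.
Hypothesis HB : bernoulli p P.
Let o : G := GRing.zero.

Let p_gt0 g : 0 < p g. Proof. by case: (p01 g). Qed.

(** By [bernoulli], this is the probability of [cylinder (periodize a) L]. *)
Definition weight (a : {ffun 'I_N -> G}) (L : nat) : R :=
  \big[Rmult/R1]_(i < L) p (periodize a i).

Lemma weight_period a : weight a N = \big[Rmult/R1]_i p (a i).
Proof. by apply: eq_bigr => i _; rewrite periodize_ord. Qed.

Lemma weight_gt0 a L : 0 < weight a L.
Proof. exact: Rprod_gt0. Qed.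

Lemma weight_add a L : weight a (L + N) = weight a N * weight a L.
Proof.
rewrite addnC /weight big_split_ord /=; congr (_ * _).
by apply: eq_bigr => i _; rewrite addnC periodize_add.
Qed.

Lemma weight_iter a q r : weight a (q * N + r) = weight a N ^ q * weight a r.
Proof.
elim: q => [|q IH]; first by rewrite /= Rmult_1_l.
by rewrite mulSn -addnA addnC weight_add IH /= Rmult_assoc.
Qed.

Variable s : G.
Local Notation u n := (Q (cylinder (fun=> s) n)).

Definition block_sum (a : {ffun 'I_N -> G}) : G := \big[GRing.add/GRing.zero]_i a i.

Lemma constant_prob n :
  u n.+1 = \big[Rplus/R0]_(a | block_sum a == s) weight a (n + N).
Proof.
rewrite /pushforward Phi_constantE (pm_sum o HP).
- by apply: eq_bigr => a _; rewrite HB.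
- by move=> a; apply: measurable_cylinder.
- by move=> a b w; apply: periodize_cylinder_inj.
Qed.

(** The product form also covers [u n = 0], where monotonicity forces [u n.+1 = 0]. *)
Lemma cond_prob_constant n :
  u n.+1 = cond_prob Q (cylinder (fun=> s) n.+1) (cylinder (fun=> s) n) * u n.
Proof.
have mu m : measurable (fun w => cylinder (fun=> s) m (Phi N w)).
  exact/measurable_Phi/measurable_cylinder.
have le : u n.+1 <= u n.
  by apply: (pm_le o HP) => // w c j jn; apply: c; rewrite /= ltnS ltnW.
have := pm_nonneg HP (mu n.+1); rewrite -/(Q _) => ge.
have e : Q (fun w => cylinder (fun=> s) n.+1 w /\ cylinder (fun=> s) n w) = u n.+1.
  congr (Q _); apply: pred_eqP => w; split=> [[] //|c].
  by split=> // j jn; apply: c; rewrite /= ltnS ltnW.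
rewrite /cond_prob e.
have [z|nz] := Req_dec (u n) 0; last by field.
by rewrite z in le *; lra.
Qed.

Variable m : R.
Hypothesis m_gt0 : 0 < m.
Hypothesis m_max : forall a, block_sum a = s -> weight a N <= m.

Definition peak_sum r : R :=
  \big[Rplus/R0]_(a | (block_sum a == s) && (weight a N == m)) weight a r.

(** A constant word of length [q * N + r + 1] reads [q + 1] full periods and [r] more letters,
    whence the exponent. After division, each period contributes with ratio [weight a N / m], equal
    to 1 on the maximisers and below 1 elsewhere. *)
Lemma constant_prob_asymp r :
  Un_cv (fun q => u (q * N + r).+1 / m ^ q.+1) (peak_sum r).
Proof.
rewrite /peak_sum big_mkcondr.
apply: (@Un_cv_ext (fun q => \big[Rplus/R0]_(a | block_sum a == s)
    ((weight a N / m) ^ q.+1 * weight a r))).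
  move=> q; rewrite constant_prob /Rdiv big_distrl /=; apply: eq_bigr => a _.
  rewrite addnAC -mulSnr weight_iter.
  rewrite -!tech_pow_Rmult Rpow_mult_distr pow_inv.
  by field; split; [apply: pow_nonzero|]; lra.
apply: Rsum_cv => a /eqP/m_max le; case: eqP => [->|ne].
  apply: Un_cv_ext (Un_cv_const _) => q.
  by rewrite Rdiv_diag ?pow1 ?Rmult_1_l //; lra.
rewrite (_ : R0 = 0 * weight a r); last by rewrite Rmult_0_l.
apply: CV_mult (Un_cv_const _).
have w0 := weight_gt0 a N.
have i0 := Rinv_0_lt_compat _ m_gt0.
have x0 : 0 < weight a N / m by apply: Rmult_lt_0_compat.
have x1 : weight a N / m < 1.
  by rewrite -(Rdiv_diag m); [apply: Rmult_lt_compat_r => //; lra | lra].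
apply: (@Un_cv_subseq (pow (weight a N / m)) 0 succn) => // e e0.
have [M HM] := pow_lt_1_zero (weight a N / m) ltac:(by rewrite Rabs_pos_eq; lra) e e0.
by exists M => n nM; rewrite /Rdist Rminus_0_r; apply: HM.
Qed.

(** One more letter multiplies the probability by a conditional probability tending to [l], with the
    same normalisation. There is no bound on [r], so the passage from [K] to [N] is included. *)
Lemma peak_sum_succ l r :
  Un_cv (fun n => cond_prob Q (cylinder (fun=> s) n.+1) (cylinder (fun=> s) n)) l ->
  peak_sum r.+1 = l * peak_sum r.
Proof.
move=> cvl; apply: UL_sequence (constant_prob_asymp r.+1) _.
have f_ge n : (n <= (n * N + r).+1)%nat.
  by rewrite ltnW // ltnS (leq_trans _ (leq_addr _ _)) // leq_pmulr.
apply: Un_cv_ext (CV_mult _ _ _ _ (Un_cv_subseq f_ge cvl) (constant_prob_asymp r)) => q.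
by rewrite addnS [in RHS]cond_prob_constant /Rdiv Rmult_assoc.
Qed.

End ConstantWord.

(** * Constant sums and products, and maxima over finite types *)

Lemma Rsum_const (I : finType) (A : {pred I}) c : \big[Rplus/R0]_(i in A) c = INR #|A| * c.
Proof.
rewrite big_const; elim: #|A| => [|n IH]; first by rewrite Rmult_0_l.
by rewrite iterS IH S_INR; lra.
Qed.

Lemma Rprod_const (I : finType) (A : {pred I}) c : \big[Rmult/R1]_(i in A) c = c ^ #|A|.
Proof. by rewrite big_const; elim: #|A| => [|n IH] //=; rewrite IH. Qed.

Lemma card_predC1_ord K (i : 'I_K.+1) : #|[pred j | j != i]| = K.
Proof. by rewrite -[RHS]/(K.+1.-1) -[in RHS](card_ord K.+1) -(cardC1 i). Qed.

Lemma Rprod_constC1 K (i : 'I_K.+1) c : \big[Rmult/R1]_(j | j != i) c = c ^ K.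
Proof. by rewrite (Rprod_const [pred j | j != i]) card_predC1_ord. Qed.

Lemma Rsum_constC1 K (i : 'I_K.+1) c : \big[Rplus/R0]_(j | j != i) c = INR K * c.
Proof. by rewrite (Rsum_const [pred j | j != i]) card_predC1_ord. Qed.

Lemma ex_maxR (I : finType) (r : pred I) (f : I -> R) i0 : r i0 ->
  exists i, r i /\ forall j, r j -> f j <= f i.
Proof.
move=> ri0; suff [i [ri le]] : exists i, r i /\ forall j, j \in index_enum I -> r j -> f j <= f i.
  by exists i; split=> // j; apply: le; rewrite mem_index_enum.
elim: (index_enum I) => [|k t [i [ri le]]]; first by exists i0.
case rk: (r k); last first.
  by exists i; split=> // j; rewrite in_cons => /orP[/eqP->|/le //]; rewrite rk.
have [ki|ik] := Rle_or_lt (f k) (f i).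
  by exists i; split=> // j; rewrite in_cons => /orP[/eqP->|/le].
exists k; split=> // j; rewrite in_cons => /orP[/eqP->|/le H /H]; lra.
Qed.

(** * The maximising periods and their prefix weights *)

Section Peaks.
Variables (G : finZmodType) (K : nat) (p : G -> R) (g h : G).
Local Notation N := K.+1.
Hypothesis p_gt0 : forall x, 0 < p x.
Hypothesis gh : g != h.
Hypothesis p_second : forall x, x != h -> p x <= p g.
Hypothesis p_gh : p g < p h.

Definition peak (i : 'I_N) : {ffun 'I_N -> G} := [ffun j => if j == i then g else h].

Definition peak_target : G := GRing.add g (GRing.natmul h K).

Local Notation m := (p g * p h ^ K).

Lemma peak_inj : injective peak.
Proof.
move=> i j /ffunP /(_ i); rewrite !ffunE eqxx.
by case: eqP => // _ /eqP; rewrite (negPf gh).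
Qed.

Lemma block_sum_const (a : {ffun 'I_N -> G}) i : (forall j, j != i -> a j = h) ->
  block_sum a = GRing.add (a i) (GRing.natmul h K).
Proof.
move=> ah; rewrite /block_sum (bigD1 i) //=; congr (GRing.add _ _).
by rewrite (eq_bigr (fun=> h)) // GRing.sumr_const card_predC1_ord.
Qed.

Lemma block_sum_peak i : block_sum (peak i) = peak_target.
Proof.
rewrite (@block_sum_const _ i) ?ffunE ?eqxx // => j.
by rewrite ffunE => /negPf->.
Qed.

Lemma weight_peak i : weight p (peak i) N = m.
Proof.
rewrite weight_period (bigD1 i) //= ffunE eqxx; congr (_ * _).
rewrite -(Rprod_constC1 i).
by apply: eq_bigr => j /negPf; rewrite ffunE => ->.
Qed.

Lemma p_le_ph x : p x <= p h.
Proof. by have [->|/p_second] := eqVneq x h; [exact: Rle_refl | lra]. Qed.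

(** The number of letters other than [h] decides: none would give [g = h], a single one must be [g]
    because of the sum, and two or more cost a further factor [p g / p h < 1]. *)
Lemma weight_target (a : {ffun 'I_N -> G}) : block_sum a = peak_target ->
  weight p a N < m \/ exists i, a = peak i.
Proof.
move=> sa.
have [i aih] : exists i, a i != h.
  apply: NNPP => no; have ah i : a i = h by apply/eqP/negPn/negP => ai; apply: no; exists i.
  move/eqP: gh; apply; apply: (GRing.addIr (GRing.natmul h K)).
  by rewrite -[LHS]sa (@block_sum_const _ ord0) // ah.
have [[j [ji ajh]]|no] := classic (exists j, j != i /\ a j != h); last first.
  have ah j : j != i -> a j = h.
    by move=> ji; apply/eqP/negPn/negP => ajh; apply: no; exists j.
  right; exists i; apply/ffunP => j; rewrite ffunE.
  have [->|/ah //] := eqVneq j i.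
  by apply: (GRing.addIr (GRing.natmul h K)); rewrite -[RHS]sa (block_sum_const ah).
left; rewrite weight_period (bigD1 i) //= -(Rprod_constC1 i).
rewrite (bigD1 j) //= [in X in _ < X](bigD1 j) //=.
(* [X] collects the letters of [a] outside positions [i] and [j]; [Y] is the same product with every
   letter replaced by [h]. *)
set X := bigop.body _ _ _; set Y := bigop.body _ _ _.
have X0 : 0 < X by apply: Rprod_gt0.
have XY : X <= Y by apply: Rprod_le => k _; split=> //; apply: p_le_ph.
have := p_second aih; have := p_second ajh; have := p_gt0 (a i); have := p_gt0 (a j).
move: (p (a i)) (p (a j)) => x y y0 x0 yg xg.
have h1 : y * X <= p g * Y by apply: Rmult_le_compat; lra.
have h2 : p g * Y < p h * Y by apply: Rmult_lt_compat_r; lra.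
apply: (Rle_lt_trans _ (p g * (p g * Y))); first by apply: Rmult_le_compat; nra.
by apply: Rmult_lt_compat_l => //; lra.
Qed.

Lemma weight_target_le (a : {ffun 'I_N -> G}) : block_sum a = peak_target -> weight p a N <= m.
Proof. by case/weight_target => [/Rlt_le //|[i ->]]; rewrite weight_peak; apply: Rle_refl. Qed.

Lemma peak_sumE r : peak_sum K p peak_target m r = \big[Rplus/R0]_i weight p (peak i) r.
Proof.
transitivity (\big[Rplus/R0]_(a in [set peak i | i : 'I_N]) weight p a r); last first.
  by rewrite big_imset //= => i j _ _; apply: peak_inj.
apply: eq_bigl => a; apply/andP/imsetP => [[/eqP sa /eqP wa]|[i _ ->]].
  by have [|[i ->]] := weight_target sa; [lra | exists i].
by rewrite block_sum_peak weight_peak !eqxx.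
Qed.

(** At a fixed position [j], exactly one of the [N] peaks carries [g]. *)
Lemma sum_peak (f : G -> R) j :
  \big[Rplus/R0]_i f (peak i j) = f g + INR K * f h.
Proof.
rewrite (bigD1 j) //= ffunE eqxx; congr (_ + _).
rewrite -(Rsum_constC1 j).
by apply: eq_bigr => i /negPf; rewrite ffunE eq_sym => ->.
Qed.

(* A prefix of length [K] misses the last letter of the period only, so its
   weight is [m] divided by the probability of that letter. *)
Lemma peak_sum_mean :
  peak_sum K p peak_target m 0 * peak_sum K p peak_target m N = INR N * (INR N * m) /\
  peak_sum K p peak_target m 1 * peak_sum K p peak_target m K =
    (p g + INR K * p h) * (m * (/ p g + INR K * / p h)).
Proof.
split.
  congr (_ * _); rewrite peak_sumE.
    under eq_bigr do rewrite /weight big_ord0.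
    by rewrite Rsum_const card_ord Rmult_1_r.
  under eq_bigr do rewrite weight_peak.
  by rewrite Rsum_const card_ord.
congr (_ * _); rewrite peak_sumE.
  rewrite -(sum_peak p ord0); apply: eq_bigr => i _.
  by rewrite /weight big_ord1 (periodize_ord _ ord0).
rewrite -(sum_peak (fun x => / p x) ord_max) big_distrr /=.
apply: eq_bigr => i _; rewrite -(weight_peak i) /weight big_ord_recr /=.
rewrite (periodize_ord _ ord_max) Rmult_assoc Rinv_r ?Rmult_1_r //.
by have := p_gt0 (peak i ord_max); lra.
Qed.

End Peaks.

Theorem theorem7 (G : finZmodType) (p : G -> R) (P : event G -> R) (N : nat) :
  (forall g : G, (0 < p g < 1)%R) ->
  \big[Rplus/R0]_(g : G) p g = R1 ->
  prob_measure P ->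
  bernoulli p P ->
  is_true (leq 2 N) ->
  T_invariant (pushforward N P) /\
  psi_mixing (pushforward N P) /\
  ((exists h : G, forall g : G, g <> h -> (p g < p h)%R) ->
   exists s : G,
     ~ (exists l : R,
          Un_cv (fun n => cond_prob (pushforward N P)
                            (cylinder (fun _ => s) n.+1)
                            (cylinder (fun _ => s) n)) l)).
Proof.
move=> p01 p_sum HP HB; case: N => // K K1.
split; first exact: pushforward_invariant HP HB.
split; first exact: pushforward_psi_mixing p01 HP HB.
move=> [h p_max]; have p_gt0 g : 0 < p g by case: (p01 g).
(* If [h] were the only letter, its probability would be 1. *)
have [x xh] : exists x, x != h.
  apply: NNPP => no; move: p_sum; rewrite (big_pred1 h) => [|x].
    by have := p01 h; lra.
  by apply/esym/negPn/negP => xh; apply: no; exists x.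
have [g [gh p_second]] := @ex_maxR _ (fun x => x != h) p x xh.
have p_gh : p g < p h by apply/p_max/eqP.
have m_gt0 : 0 < p g * p h ^ K by apply: Rmult_lt_0_compat => //; apply: pow_lt.
exists (peak_target K g h) => -[l cvl].
have succ r := peak_sum_succ p01 HP HB m_gt0 (weight_target_le p_gt0 gh p_second p_gh) r cvl.
have [S0N S1K] := peak_sum_mean K p_gt0 gh p_second p_gh.
have /lt_INR /= K0 : (0 < K)%coq_nat by apply/ltP.
(* Both products become [l] times the peak sums at 0 and at [K], so the two right-hand sides
   coincide. *)
move: S0N S1K; rewrite !succ S_INR.
move: (peak_sum _ _ _ _ _) (peak_sum _ _ _ _ _) (p_gt0 g) (p_gt0 h) m_gt0 => S0 SK.
move: (p g) (p h) (INR K) K0 p_gh (_ * _) => u v k k0 uv m u0 v0 m0 S0N S1K.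
have e : m * ((u + k * v) * (/ u + k * / v) - (k + 1) * (k + 1)) = 0 by nra.
(* The excess [(u + k * v) * (/ u + k * / v) - (k + 1) * (k + 1)] equals [k * (u - v)^2 / (u * v)],
   which is positive because [k > 0] and [u < v]. *)
have : m * (k * ((u - v) * (u - v))) = 0.
  rewrite -(Rmult_0_r (u * v)) -{}e; field; lra.
have : 0 < m * (k * ((u - v) * (u - v))); last by lra.
by apply: Rmult_lt_0_compat => //; apply: Rmult_lt_0_compat => //; nra.
Qed.
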